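(* Let $2\mathbb{N}$ denote the set of even natural numbers. Then $$\frac{n!}{2\left[n-3+\binom{\lceil n/2\rceil+1}{2}\right]}\le M(n,2\mathbb{N})\le\frac{n!}{2n}$$ if $n$ is odd, and $$\frac{n!}{2\binom{n/2+1}{2}}\le M(n,2\mathbb{N})\le\frac{n!}{8}$$ if $n$ is even.
   Context: $K_n$ is the complete graph on $n$ vertices. Hamiltonian paths of $K_n$ are undirected and are regarded as (labelled) subgraphs of $K_n$. For a set $\mathbb{D}\subseteq\mathbb{N}$ of natural numbers, two Hamiltonian paths in $K_n$ are called $\mathbb{D}$-cycle different if the union of the two paths (the graph whose edge set is the union of their edge sets) contains a cycle, not necessarily induced, whose length belongs to $\mathbb{D}$. $M(n,\mathbb{D})$ denotes the largest cardinality of a set of pairwise $\mathbb{D}$-cycle different Hamiltonian paths in $K_n$, that is, a set any two distinct members of which are $\mathbb{D}$-cycle different.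
   Formalization: The upper bounds are claimed only for odd n ≥ 3 and even n ≥ 6, since they fail as printed for n = 1 (M = 1 > 1/2), n = 2 (M = 1 > 1/4) and n = 4 (the lower bound gives 4 > 3); the lower bounds are stated for all n ≥ 1. *)

(* Defs.v *)
From mathcomp Require Import all_boot all_order all_algebra.

Set Implicit Arguments.
Unset Strict Implicit.
Unset Printing Implicit Defensive.

(* A spanning subgraph of K_n is represented by its edge set, an edge being a
   two-element set of vertices. *)
Definition graph (n : nat) : Type := {set {set 'I_n}}.

Definition path_graph (n : nat) (s : seq 'I_n) : graph n :=
  [set e in [seq [set p.1; p.2] | p <- zip s (behead s)]].

(* Paths are undirected: an ordering of the vertices and its reversal yield the
   same element. *)
Definition ham_paths (n : nat) : {set graph n} :=
  [set path_graph (val s) | s : n.-tuple 'I_n & uniq s].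

(* [cycle] alone would accept sequences of size 1 or 2, hence 2 < size c. *)
Definition is_cycle (n : nat) (G : graph n) (c : seq 'I_n) : bool :=
  [&& 2 < size c, uniq c & cycle (fun x y => [set x; y] \in G) c].

(* The vertices of a cycle are distinct, so lengths up to n suffice; see
   [has_cycleP]. *)
Definition has_cycle (n : nat) (D : {pred nat}) (G : graph n) : bool :=
  [exists l : 'I_n.+1, (val l \in D) && [exists c : l.-tuple 'I_n, is_cycle G c]].

Lemma has_cycleP (n : nat) (D : {pred nat}) (G : graph n) :
  reflect (exists2 c : seq 'I_n, is_cycle G c & size c \in D) (has_cycle D G).
Proof.
apply: (iffP existsP) => [[l /andP[Dl /existsP[c Gc]]]|[c Gc Dc]].
  by exists c => //; rewrite size_tuple.
have le_cn : size c < n.+1.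
  by case/and3P: Gc => _ Uc _; rewrite ltnS -[n in _ <= n]card_ord -(card_uniqP Uc) max_card.
exists (Ordinal le_cn); rewrite Dc; apply/existsP.
by exists (in_tuple c).
Qed.

Definition cycle_different (n : nat) (D : {pred nat}) (P Q : graph n) : bool :=
  has_cycle D (P :|: Q).

Definition cycle_different_family (n : nat) (D : {pred nat})
    (F : {set graph n}) : bool :=
  (F \subset ham_paths n) &&
  [forall P in F, forall Q in F, (P != Q) ==> cycle_different D P Q].

Definition M (n : nat) (D : {pred nat}) : nat :=
  \max_(F : {set graph n} | cycle_different_family D F) #|F|.

Definition evens : {pred nat} := [pred k | ~~ odd k].

(* Main.v *)
Require Import Defs.
From mathcomp Require Import all_boot all_order all_algebra.
From mathcomp Require Import fingroup perm zify.

Set Implicit Arguments.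
Unset Strict Implicit.
Unset Printing Implicit Defensive.

(** Every Hamiltonian path of K_n is the image of the standard path 0, 1, ...,
    n - 1 under a permutation of the vertices.  Both bounds come from counting
    those permutations.

    Upper bounds.  Let T be a graph without even cycles.  A family of pairwise
    different paths has at most one member inside each relabelled copy of T,
    and a member P = tau(std_path) lies in the copy tau p^-1 (T) for every
    ordering p of a Hamiltonian path of T.  The copies so obtained are distinct
    as permutations, so the size of the family times the number of these
    orderings is at most n! ([template_bound]).  For n odd, T is the Hamiltonian
    cycle, which has 2n such orderings (the dihedral group).  For n > 4, T is
    the path with a triangle closed at each end, and at least 8 orderings are
    obtained by flipping either end and reversing.

    Lower bounds.  A largest family is maximal, so the paths that fail to be
    different from some member cover all n!/2 Hamiltonian paths
    ([greedy_bound], [leq_card_ham_paths]).  What remains is to bound the number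
    of paths Q whose union with the standard path has no even cycle.  Call an
    edge of Q joining two vertices that are not consecutive integers a chord
    and view it as the interval it spans.  A chord together with its interval
    is a cycle, so its span is even; two chords over a common standard edge
    form with the standard path a theta graph, which contains an even cycle, so
    chords span edge-disjoint intervals ([chord_disjoint]).  As Q is connected
    and acyclic, the standard edges missing from Q (the gaps) match the chords
    one to one, each gap lying under its chord.  Finally vertices have degree
    at most 2 in Q, so a chord with a gap away from its left end starts at
    vertex 0 and one with a gap away from its right end ends at vertex n - 1.
    Hence Q is the standard path with two edge-disjoint end segments closed up
    by a chord and reopened next to the rest of the path, or, for n odd, the
    Hamiltonian cycle minus an edge.  Counting the possible lengths gives the
    two denominators ([path_graph_candidates], [size_candidates]). *)

(** * Paths, cycles and relabellings *)

Section Basics.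
Variable n : nat.
Implicit Types (G H T : graph n) (s c : seq 'I_n) (x y z : 'I_n).

Lemma set2_eqP (T : finType) (x y a b : T) :
  [set x; y] = [set a; b] -> (x = a /\ y = b) \/ (x = b /\ y = a).
Proof.
move=> /setP E.
have := (E x, E y, (E a, E b)); rewrite !inE !eqxx ?orbT /=.
case=> -[/esym/orP[/eqP->|/eqP->] /esym/orP[/eqP->|/eqP->]] [];
  rewrite ?eqxx ?orbT; auto; rewrite !orbb => /eqP E1 /eqP E2; subst; auto.
Qed.

Lemma path_graph_index s x y : uniq s -> [set x; y] \in path_graph s ->
  [/\ x \in s, y \in s &
      (index x s).+1 = index y s \/ (index y s).+1 = index x s].
Proof.
move=> Us; rewrite inE => /mapP[p /(nthP (x, x))[k]].
rewrite size_zip size_behead => klt <-{p}.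
have k1 : k.+1 < size s by move: klt; rewrite leq_min ltn_predRL => /andP[].
rewrite nth_zip_cond size_zip size_behead klt /= nth_behead.
by case/set2_eqP=> -[-> ->]; rewrite !mem_nth ?index_uniq // 1?ltnW //;
   split=> //; [left|right].
Qed.

Lemma path_graph_nth s x0 k : k.+1 < size s ->
  [set nth x0 s k; nth x0 s k.+1] \in path_graph s.
Proof.
move=> lt; rewrite inE; apply/mapP; exists (nth x0 s k, nth x0 s k.+1) => //.
have klt : k < size (zip s (behead s)).
  by rewrite size_zip size_behead leq_min ltn_predRL lt ltnW.
have := mem_nth (x0, x0) klt.
by rewrite nth_zip_cond klt nth_behead.
Qed.

Definition std_path : graph n := path_graph (enum 'I_n).

Lemma std_pathE x y :
  ([set x; y] \in std_path) = (x.+1 == y) || (y.+1 == x).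
Proof.
apply/idP/idP.
  move/(path_graph_index (enum_uniq _)); rewrite !index_enum_ord.
  by case=> _ _ [->|->]; rewrite eqxx ?orbT.
have H (a b : 'I_n) : a.+1 = b -> [set a; b] \in std_path.
  move=> ab; have lt : a.+1 < size (enum 'I_n) by rewrite ab size_enum_ord.
  have nthE (i : 'I_n) : nth a (enum 'I_n) i = i.
    by apply: val_inj; rewrite /= nth_enum_ord.
  by have := path_graph_nth a lt; rewrite ab !nthE.
by case/orP=> /eqP E; [|rewrite setUC]; apply: H.
Qed.

Lemma std_path_edge e : e \in std_path -> exists x y, e = [set x; y].
Proof. by rewrite inE => /mapP[[x y] _ ->]; exists x, y. Qed.

Lemma is_cycle_rot G c i : is_cycle G (rot i c) = is_cycle G c.
Proof. by rewrite /is_cycle size_rot rot_uniq rot_cycle. Qed.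

Lemma is_cycle_rev G c : is_cycle G (rev c) = is_cycle G c.
Proof.
rewrite /is_cycle size_rev rev_uniq rev_cycle; congr [&& _, _ & _].
by apply: eq_cycle => x y; rewrite setUC.
Qed.

Lemma cycle_two_neighbours G c x : is_cycle G c -> x \in c ->
  exists y z, [/\ y \in c, z \in c, y != z,
                  [set x; y] \in G & [set x; z] \in G].
Proof.
move=> Cc /rot_to[i c' E]; move: Cc.
have memE w : (w \in c) = (w \in rot i c) by rewrite mem_rot.
rewrite -(is_cycle_rot G c i); move: memE; rewrite E.
case: c' {E} => [|y c'] memE //.
case/lastP: c' memE => [|c' z] memE // /and3P[_ U].
rewrite /= rcons_path last_rcons => /and3P[xy _ zx].
exists y, z; rewrite !memE; split=> //; last by rewrite setUC.
- by rewrite !inE eqxx orbT.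
- by rewrite !(inE, mem_rcons) eqxx !orbT.
by move: U => /= /and3P[_ + _]; rewrite mem_rcons inE negb_or => /andP[].
Qed.

(** The source of all proofs of acyclicity below: with a well chosen rank [r], a
    vertex of highest rank would need two neighbours that are not above it. *)
Lemma cycle_peak (r : 'I_n -> nat) G c : is_cycle G c ->
  exists x y z, [/\ x \in c, y != z, {in c, forall w, r w <= r x},
    y \in c /\ z \in c & [set x; y] \in G /\ [set x; z] \in G].
Proof.
move=> Cc; case Ec: c => [|x0 c']; first by rewrite Ec in Cc.
rewrite -Ec; have x0c : x0 \in c by rewrite Ec mem_head.
case: (arg_maxnP r x0c) => x xc xmax.
have [y [z [yc zc yz xy xz]]] := cycle_two_neighbours Cc xc.
by exists x, y, z.
Qed.

Lemma path_graph_acyclic s c : uniq s -> is_cycle (path_graph s) c -> False.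
Proof.
move=> Us /(cycle_peak (fun x => index x s))[x [y [z [_ yz m [yc zc] [xy xz]]]]].
have [_ ys iy] := path_graph_index Us xy; have [_ zs iz] := path_graph_index Us xz.
case/eqP: yz; apply: (@index_inj _ x s) => //.
by have := m _ yc; have := m _ zc; lia.
Qed.

Definition relabel (f : 'I_n -> 'I_n) G : graph n := [set f @: e | e : {set 'I_n} in G].

Lemma imset_set2 (f : 'I_n -> 'I_n) x y : f @: [set x; y] = [set f x; f y].
Proof. by rewrite imsetU1 imset_set1. Qed.

Lemma relabel_path f s : relabel f (path_graph s) = path_graph (map f s).
Proof.
have -> : path_graph (map f s) = [set e in [seq f @: [set p.1; p.2] | p <- zip s (behead s)]].
  rewrite /path_graph behead_map.
  have -> (a b : seq 'I_n) : zip (map f a) (map f b) = [seq (f p.1, f p.2) | p <- zip a b].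
    by elim: a b => [|x a IH] [|y b] //=; rewrite IH.
  apply/setP=> e; rewrite !inE -map_comp; congr (e \in _).
  by apply: eq_map => p /=; rewrite imset_set2.
apply/setP=> e; rewrite inE; apply/imsetP/mapP.
  by case=> e'; rewrite inE => /mapP[p pz ->] ->; exists p.
by case=> p pz ->; exists [set p.1; p.2] => //; rewrite inE; apply/mapP; exists p.
Qed.

Lemma relabelU f G H : relabel f (G :|: H) = relabel f G :|: relabel f H.
Proof. exact: imsetU. Qed.

Lemma relabelS f G H : G \subset H -> relabel f G \subset relabel f H.
Proof. exact: imsetS. Qed.

Lemma relabel_comp f g G : relabel (f \o g) G = relabel f (relabel g G).
Proof.
by rewrite /relabel -imset_comp; apply: eq_imset => e /=; rewrite imset_comp.
Qed.

Lemma eq_relabel f g G : f =1 g -> relabel f G = relabel g G.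
Proof. by move=> fg; apply: eq_imset => e; apply: eq_imset. Qed.

Lemma relabel_id G : relabel id G = G.
Proof.
by rewrite -[RHS]imset_id; apply: eq_imset => e; rewrite imset_id.
Qed.

Lemma has_cycle_relabel D (f : 'I_n -> 'I_n) G : injective f ->
  has_cycle D G -> has_cycle D (relabel f G).
Proof.
move=> fI /has_cycleP[c /and3P[c2 Uc Cc] Dc].
apply/has_cycleP; exists (map f c); last by rewrite size_map.
rewrite /is_cycle size_map c2 (map_inj_uniq fI) Uc /= cycle_map.
apply: sub_cycle Cc => x y /=; rewrite -imset_set2; exact: imset_f.
Qed.

Lemma has_cycle_relabelP D (p : {perm 'I_n}) G :
  has_cycle D (relabel p G) = has_cycle D G.
Proof.
apply/idP/idP; last exact: has_cycle_relabel perm_inj.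
move/(has_cycle_relabel (@perm_inj _ p^-1%g)); rewrite -relabel_comp.
rewrite (@eq_relabel _ id) ?relabel_id //; exact: permK.
Qed.

Lemma has_cycleS D G H : G \subset H -> has_cycle D G -> has_cycle D H.
Proof.
move=> /subsetP GH /has_cycleP[c /and3P[c2 Uc Cc] Dc].
apply/has_cycleP; exists c => //; rewrite /is_cycle c2 Uc.
apply: sub_cycle Cc => x y; exact: GH.
Qed.

Lemma ham_pathsP G :
  reflect (exists p : 'S_n, G = relabel p std_path) (G \in ham_paths n).
Proof.
apply: (iffP imsetP) => [[s + ->]|[p ->]].
  rewrite inE => /tuple_uniqP sI.
  exists (perm sI); rewrite relabel_path; congr path_graph.
  rewrite -[LHS](map_tnth_enum s); apply: eq_map => i; by rewrite permE.
rewrite relabel_path; exists (map_tuple p (ord_tuple n)).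
  by rewrite inE (map_inj_uniq perm_inj) -[X in uniq X]/(val (ord_tuple n)) val_ord_tuple enum_uniq.
by congr path_graph; rewrite -val_ord_tuple.
Qed.

End Basics.

(** * Upper bounds *)

(** Double counting of the copies of [T]: two members of the family inside one
    copy would have their union inside it, hence free of cycles with length in
    [D]. *)
Lemma template_bound (n : nat) (D : {pred nat}) (T : graph n) :
  ~~ has_cycle D T ->
  M n D * #|[set p : 'S_n | relabel p (std_path n) \subset T]| <= n`!.
Proof.
move=> TD; set H := [set p | _].
have F0 : 0 < #|cycle_different_family (n := n) D|.
  apply/card_gt0P; exists set0; rewrite unfold_in /cycle_different_family.
  by rewrite sub0set; apply/forallP=> P; rewrite inE.
have [F FD MF] := eq_bigmax_cond (fun F : {set graph n} => #|F|) F0.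
rewrite [M n D]MF {MF}.
case/andP: FD => /subsetP Fham /forall_inP Fdiff.
pose tau P := odflt 1%g [pick p : 'S_n | P == relabel p (std_path n)].
have tauP P : P \in F -> P = relabel (tau P) (std_path n).
  move/Fham => /ham_pathsP[p0 Ep0]; rewrite /tau.
  by case: pickP => [p /eqP //|/(_ p0)]; rewrite Ep0 eqxx.
rewrite -(card_Sn n) -cardsX.
(* phi (P, p) sends T to a copy that contains P. *)
pose phi (u : graph n * 'S_n) : 'S_n := (u.2^-1 * tau u.1)%g.
suff phiI : {in setX F H &, injective phi} by rewrite -(card_in_imset phiI) max_card.
have sub P p : P \in F -> p \in H -> P \subset relabel (phi (P, p)) T.
  move=> PF; rewrite inE => /(relabelS (phi (P, p))); apply: subset_trans.
  rewrite -relabel_comp {1}(tauP _ PF).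
  rewrite (@eq_relabel _ _ (tau P)) // => x; by rewrite /phi /= permM permK.
case=> [P p] [Q q] /setXP[/= PF pH] /setXP[/= QF qH] E.
have PQ : P = Q.
  apply/eqP; apply: contraT => nPQ.
  have := implyP (forall_inP (Fdiff _ PF) _ QF) nPQ.
  move=> /(@has_cycleS _ _ _ (relabel (phi (P, p)) T)).
  rewrite has_cycle_relabelP (negbTE TD); apply.
  by rewrite subUset {2}E !sub.
by move: E; rewrite /phi /= PQ => /mulIg/invg_inj ->.
Qed.

Section HamCycle.
Variable m : nat.
(* At least two vertices, so that vertices form a ring with 0 <> 1. *)
Local Notation n := m.+2.
Implicit Types (x y z v : 'I_n).
Import GRing.Theory.
Local Open Scope ring_scope.

Definition ham_cycle : graph n := [set [set x; x + 1] | x : 'I_n].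

Lemma ham_cycleE x y :
  ([set x; y] \in ham_cycle) = (y == x + 1) || (x == y + 1).
Proof.
apply/imsetP/idP; last first.
  by case/orP=> /eqP E; [exists x | exists y]; rewrite // E // setUC.
by case=> z _ /set2_eqP[] [-> ->]; rewrite eqxx ?orbT.
Qed.

Lemma val_ord_succ x : val (x + 1) = if x == n.-1 :> nat then 0%N else x.+1.
Proof.
have -> : val (x + 1) = ((x + 1) %% n)%N.
  by rewrite /= [X in (x + X)%N]modn_small.
case: eqP => [->|/eqP ne]; first by rewrite addn1 modnn.
have := ltn_ord x; rewrite addn1 => lt; rewrite modn_small //.
by move: ne lt; rewrite /=; lia.
Qed.

(** An even cycle has length other than [n], so it misses a vertex [v]; cutting
    the Hamiltonian cycle open at [v] ranks the other vertices so that each has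
    a single lower neighbour. *)
Lemma ham_cycle_no_even : odd n -> ~~ has_cycle evens ham_cycle.
Proof.
move=> on; apply/has_cycleP=> -[c Cc ec].
have [v vc] : exists v, v \notin c.
  apply/existsP; rewrite -negb_forall; apply/forallP => allc.
  case/and3P: Cc => _ /card_uniqP Uc _; move: ec; rewrite inE -Uc.
  by rewrite (@eq_card _ _ predT) ?card_ord ?on // => x; rewrite allc.
have [x [y [z [xc yz mx [yc zc] [xy xz]]]]] := cycle_peak (fun x => val (x - v)) Cc.
have lower w : w \in c -> [set x; w] \in ham_cycle -> x = w + 1.
  move=> wc; rewrite ham_cycleE => /orP[/eqP wx|/eqP //].
  have := mx w wc; rewrite wx addrAC val_ord_succ.
  case: eqP => [e _|_]; last by rewrite ltnn.
  have w0 : val (w - v) = 0%N by rewrite wx addrAC val_ord_succ e eqxx.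
  have E : w - v = 0 by apply: val_inj.
  by move: vc; rewrite -(subr0_eq E) wc.
case/eqP: yz; apply: (@addIr _ 1); by rewrite -!lower.
Qed.

Definition rotation_reflection (u : 'I_n * bool) x : 'I_n :=
  if u.2 then u.1 - x else u.1 + x.

Lemma rotation_reflection_inj u : injective (rotation_reflection u).
Proof.
case: u => k [] x y; rewrite /rotation_reflection /=.
  by move/addrI/oppr_inj.
by move/addrI.
Qed.

Lemma std_path_ham_cycle : std_path n \subset ham_cycle.
Proof.
apply/subsetP=> e He; have [x [y E]] := std_path_edge He; rewrite E in He *.
have H (a b : 'I_n) : a.+1 = b -> b = a + 1.
  move=> ab; apply: val_inj; rewrite val_ord_succ; case: eqP => // an.
  by have := ltn_ord b; rewrite -ab an /= ltnn.
by rewrite ham_cycleE; move: He; rewrite std_pathE => /orP[] /eqP /H ->; rewrite eqxx ?orbT.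
Qed.

Lemma ham_cycle_orderings : (2 < n)%N ->
  (n * 2 <= #|[set p : 'S_n | relabel p (std_path n) \subset ham_cycle]|)%N.
Proof.
move=> n2.
have -> : (n * 2 = #|{: 'I_n * bool}|)%N by rewrite card_prod card_ord card_bool.
pose phi u : 'S_n := perm (@rotation_reflection_inj u).
have phiI : injective phi.
  case=> [k b] [l d] E; have E1 x : rotation_reflection (k, b) x = rotation_reflection (l, d) x.
    by have := congr1 (fun p : 'S_n => p x) E; rewrite !permE.
  have := E1 0; have := E1 1; rewrite /rotation_reflection /=.
  (* 1 <> -1 separates rotations from reflections; it fails for n = 2. *)
  have n11 : 1 != - 1 :> 'I_n.
    rewrite -subr_eq0 opprK; apply/eqP => /(congr1 val).
    by rewrite /= !modn_small //; move: n2; lia.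
  case: b {E E1}; case: d; rewrite ?subr0 ?addr0 => + kl; rewrite ?kl // => /addrI /eqP.
    by rewrite eq_sym (negbTE n11).
  by rewrite (negbTE n11).
rewrite -(card_imset _ phiI); apply/subset_leq_card/subsetP => _ /imsetP[u _ ->].
rewrite inE; apply: subset_trans (relabelS _ std_path_ham_cycle) _.
apply/subsetP => _ /imsetP[_ /imsetP[x _ ->] ->].
rewrite imset_set2 !permE ham_cycleE /rotation_reflection; case: u.2.
  by rewrite opprD addrA subrK eqxx orbT.
by rewrite addrA eqxx.
Qed.

End HamCycle.

Definition graph_of (n : nat) (e : rel nat) : graph n :=
  [set [set p.1; p.2] | p : 'I_n * 'I_n & (p.1 < p.2) && e p.1 p.2].

Lemma graph_ofE n (e : rel nat) (x y : 'I_n) :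
  ([set x; y] \in graph_of n e) = (x < y) && e x y || (y < x) && e y x.
Proof.
apply/imsetP/idP => [[[a b]]|].
  by rewrite inE /= => H /set2_eqP[] [-> ->]; rewrite H ?orbT.
case/orP=> H; [by exists (x, y); rewrite ?inE | exists (y, x); rewrite ?inE //].
by rewrite setUC.
Qed.

(** A cycle through [x] has both [y] and [z] next to [x]; continuing from [y] it can
    only go to [z], where it closes. *)
Lemma cycle_triangle n (G : graph n) c x y z : is_cycle G c -> x \in c ->
  (forall w, [set x; w] \in G -> w = y \/ w = z) ->
  (forall w, [set y; w] \in G -> w = x \/ w = z) -> size c = 3.
Proof.
move=> Cc /rot_to[i c' E] Nx Ny; rewrite -(size_rot i) E.
rewrite -(is_cycle_rot G c i) E in Cc.
have main d : is_cycle G (x :: y :: d) -> size d = 1.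
  case: d => [|u d] // /and3P[_ + /=].
  rewrite rcons_path /= => U /and3P[_ /Ny uE /andP[_]].
  rewrite setUC => /Nx lE.
  have ux : u != x by apply: contraL U => /eqP->; rewrite !inE eqxx orbT.
  have ly : last u d != y.
    by apply: contraL U => /eqP <-; rewrite mem_last andbF.
  case: uE U => [/eqP|->]; first by rewrite (negbTE ux).
  case: lE ly => [->|lz _]; first by rewrite eqxx.
  by case: d lz => [|w d] //= <-; rewrite mem_last !andbF.
case: c' Cc {E} => [|u c'] // Cc.
have [E|uy] := eqVneq u y; first by rewrite E in Cc; rewrite /= (main c').
have uz : u = z.
  have /Nx[E|//] : [set x; u] \in G by case/and3P: Cc => _ _ /= /andP[].
  by rewrite E eqxx in uy.
case/lastP: c' Cc => [|c' w] // Cc.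
have wy : w = y.
  have /Nx[//|wz] : [set x; w] \in G.
    case/and3P: Cc => _ _; rewrite /= rcons_path last_rcons => /and3P[_ _].
    by rewrite setUC.
  case/and3P: Cc => _ /= /and3P[_ +]; rewrite uz wz.
  by rewrite mem_rcons inE eqxx.
suff : size (rev (u :: c')) = 1 by rewrite /= size_rcons size_rev /= => ->.
apply: main; rewrite -wy -(is_cycle_rot G _ 1) rot1_cons rcons_cons.
by rewrite -(is_cycle_rev G) /= rev_cons rev_rcons revK.
Qed.

Section TwoTriangles.
Variable n : nat.
Hypothesis n4 : 4 < n.

Definition two_triangles_rel (i j : nat) : bool :=
  [|| i.+1 == j, (i == 0) && (j == 2) | (i + 3 == n) && (j + 1 == n)].
Definition two_triangles : graph n := graph_of n two_triangles_rel.

(** The flags ask for exchanging the first two vertices, exchanging the last two,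
    and, before that, reversing. *)
Definition end_flips (b : bool * bool * bool) (i : nat) : nat :=
  let j := if b.2 then n.-1 - i else i in
  if b.1.1 && (j < 2) then 1 - j
  else if b.1.2 && (n <= j + 2) then n + n - 3 - j else j.

Lemma end_flips_lt b i : i < n -> end_flips b i < n.
Proof. by case: b => [[[] []] []] /=; rewrite /end_flips /=; do ?case: ifP; lia.
Qed.

Lemma end_flips_inj b i j : i < n -> j < n -> end_flips b i = end_flips b j -> i = j.
Proof.
by case: b => [[[] []] []]; rewrite /end_flips /=; do ?case: ifP; lia.
Qed.

Lemma end_flips_edge b i : i.+1 < n ->
  let x := end_flips b i in let y := end_flips b i.+1 in
  (x < y) && two_triangles_rel x y || (y < x) && two_triangles_rel y x.
Proof.
by rewrite /two_triangles_rel; case: b => [[[] []] []]; rewrite /end_flips /=; do ?case: ifP; lia.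
Qed.

Lemma end_flips_ends b b' : end_flips b 0 = end_flips b' 0 ->
  end_flips b n.-1 = end_flips b' n.-1 -> b = b'.
Proof.
by case: b b' => [[[] []] []] [[[] []] []] //; rewrite /end_flips /=;  do ?case: ifP; lia.
Qed.

Definition end_flips_ord b (i : 'I_n) : 'I_n := Ordinal (end_flips_lt b (ltn_ord i)).

Lemma end_flips_ord_inj b : injective (end_flips_ord b).
Proof.
move=> x y /(congr1 val); move/end_flips_inj => E; apply: val_inj; exact: E.
Qed.

Lemma two_triangles_orderings :
  8 <= #|[set p : 'S_n | relabel p (std_path n) \subset two_triangles]|.
Proof.
pose phi u : 'S_n := perm (@end_flips_ord_inj u).
have phiI : injective phi.
  move=> b b' E; have n0 : 0 < n by lia. have n1 : n.-1 < n by lia.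
  have E1 x : end_flips_ord b x = end_flips_ord b' x.
    by have := congr1 (fun p : 'S_n => p x) E; rewrite !permE.
  by apply: end_flips_ends; 
    [have := E1 (Ordinal n0) | have := E1 (Ordinal n1)] => /(congr1 val).
have -> : 8 = #|{: bool * bool * bool}| by rewrite !card_prod !card_bool.
rewrite -(card_imset _ phiI); apply/subset_leq_card/subsetP => _ /imsetP[b _ ->].
rewrite inE; apply/subsetP => _ /imsetP[e He ->].
have [x [y E]] := std_path_edge He; rewrite E std_pathE in He *.
wlog xy : x y {E} He / x.+1 = y.
  by move=> W; case/orP: (He) => /eqP; [|rewrite setUC]; apply: W => //; rewrite orbC.
rewrite imset_set2 !permE graph_ofE /= -xy.
by apply: end_flips_edge; rewrite xy.
Qed.

(** A cycle through vertex 0 or [n - 1] is a triangle by [cycle_triangle]; on the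
    remaining vertices only a path is left. *)
Lemma two_triangles_no_even : ~~ has_cycle evens two_triangles.
Proof.
apply/has_cycleP => -[c Cc ec].
have sc : size c != 3 by apply: contraL ec => /eqP->.
have n0 : 0 < n by lia. have n1 : 1 < n by lia. have n2 : 2 < n by lia.
have m1 : n - 1 < n by lia. have m2 : n - 2 < n by lia. have m3 : n - 3 < n by lia.
pose o i (lt : i < n) : 'I_n := Ordinal lt.
have c0 : o _ n0 \notin c.
  apply: contra sc => c0; apply/eqP.
  apply: (cycle_triangle (y := o _ n1) (z := o _ n2) Cc c0) => w;
    rewrite graph_ofE /two_triangles_rel /= => H; 
    [suff : w = 1 :> nat \/ w = 2 :> nat by case=> E; [left|right]; apply: val_inj
    |suff : w = 0 :> nat \/ w = 2 :> nat by case=> E; [left|right]; apply: val_inj]; lia.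
have cn : o _ m1 \notin c.
  apply: contra sc => c1; apply/eqP.
  apply: (cycle_triangle (y := o _ m2) (z := o _ m3) Cc c1) => w;
    rewrite graph_ofE /two_triangles_rel /= => H; have := ltn_ord w => lw;
    [suff : w = n - 2 :> nat \/ w = n - 3 :> nat by case=> E; [left|right]; apply: val_inj
    |suff : w = n - 1 :> nat \/ w = n - 3 :> nat by case=> E; [left|right]; apply: val_inj]; lia.
have [x [y [z [xc yz mx [yc zc] [xy xz]]]]] := cycle_peak val Cc.
have lower w : w \in c -> [set x; w] \in two_triangles -> w.+1 = x :> nat.
  move=> wc; have := mx _ wc; rewrite graph_ofE /two_triangles_rel.
  have w0 : w != 0 :> nat by apply: contra c0 => /eqP E; rewrite (_ : o _ n0 = w) //; apply: val_inj.
  have x0 : x.+1 != n :> nat.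
    apply: contra cn => /eqP E; rewrite (_ : o _ m1 = x) //; apply: val_inj => /=.
    by clear -n4 E; lia.
  by clear -n4 w0 x0; rewrite /=; lia.
case/eqP: yz; apply: val_inj; apply: succn_inj.
by rewrite (lower _ yc xy) (lower _ zc xz).
Qed.
End TwoTriangles.

(** * Greedy lower bound *)

Lemma card_bigcup_bound (I T : finType) (F : {set I}) (B : I -> {set T}) d :
  (forall i, i \in F -> #|B i| <= d) -> #|\bigcup_(i in F) B i| <= #|F| * d.
Proof.
move=> Bd; rewrite -sum_nat_const.
apply: (@leq_trans (\sum_(i in F) #|B i|)); last exact: leq_sum.
elim/big_ind2: _ => [|A k C l Ak Cl|//]; first by rewrite cards0.
by apply: leq_trans (leq_card_setU _ _) _; apply: leq_add.
Qed.

Lemma ham_path_acyclic n D (P : graph n) : P \in ham_paths n -> ~~ has_cycle D P.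
Proof.
case/imsetP=> s; rewrite inE => Us ->.
by apply/has_cycleP => -[c /(path_graph_acyclic Us)].
Qed.

(** In a largest family, a path different from all members could be added.  The
    members themselves are covered too, as a path is not different from
    itself. *)
Lemma greedy_bound n D d :
  (forall P, P \in ham_paths n ->
     #|[set Q in ham_paths n | ~~ cycle_different D P Q]| <= d) ->
  #|ham_paths n| <= M n D * d.
Proof.
move=> Bd.
have F0 : 0 < #|cycle_different_family (n := n) D|.
  apply/card_gt0P; exists set0; rewrite unfold_in /cycle_different_family.
  by rewrite sub0set; apply/forallP=> P; rewrite inE.
have [F FD MF] := eq_bigmax_cond (fun F : {set graph n} => #|F|) F0.
rewrite [M n D]MF; case/andP: (FD) => Fham /forall_inP Fdiff.
have := card_bigcup_bound (fun P PF => Bd P (subsetP Fham P PF)).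
apply: leq_trans; apply/subset_leq_card/subsetP => Q Qham.
apply/bigcupP; have [QF|QF] := boolP (Q \in F).
  exists Q => //; rewrite inE Qham /cycle_different setUid.
  exact: ham_path_acyclic.
apply/exists_inP; apply: contraT; rewrite negb_exists_in => /forall_inP allF.
have diffQ P : P \in F -> cycle_different D P Q.
  by move/allF; rewrite inE Qham negbK.
suff FQD : cycle_different_family D (Q |: F).
  have : #|Q |: F| <= #|F|.
    by rewrite -[X in _ <= X]MF; apply: (leq_bigmax_cond (F := fun F : {set graph n} => #|F|)).
  by rewrite cardsU1 QF ltnn.
rewrite /cycle_different_family subUset sub1set Qham Fham /=.
apply/forall_inP => P /setU1P PF; apply/forall_inP => R /setU1P RF.
apply/implyP => PR; case: PF RF PR => [->|PF] [->|RF] PR.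
- by rewrite eqxx in PR.
- by rewrite /cycle_different setUC; apply: diffQ.
- exact: diffQ.
- exact: (implyP (forall_inP (Fdiff P PF) R RF)).
Qed.

(** Consecutive integers have consecutive images, and injectivity forbids turning
    back, so the first step determines the direction for good. *)
Lemma std_path_automorphism n (s : 'S_n) :
  relabel s (std_path n) \subset std_path n ->
  s = 1%g \/ s = perm (@rev_ord_inj n).
Proof.
case: n s => [|m] s sub; first by left; apply/permP => -[].
pose f i := val (s (inord i : 'I_m.+1)).
have step i : i < m -> f i.+1 = (f i).+1 \/ (f i.+1).+1 = f i.
  move=> im; have : [set inord i; inord i.+1] \in std_path m.+1.
    by rewrite std_pathE !inordK ?eqxx // ltnS ltnW.
  move/(imset_f (fun e : {set 'I__} => s @: e))/(subsetP sub).
  by rewrite imset_set2 std_pathE => /orP[] /eqP; [left|right].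
have fI i j : i <= m -> j <= m -> f i = f j -> i = j.
  move=> im jm /val_inj/perm_inj/(congr1 val); by rewrite /= !inordK.
have fm i : f i <= m by rewrite -ltnS ltn_ord.
have [m0|m0] := posnP m.
  by left; apply/permP => i; apply: val_inj; rewrite perm1 /=;
    have := ltn_ord i; have := ltn_ord (s i); lia.
have ext (g : 'I_m.+1 -> 'I_m.+1) : (forall i, i <= m -> f i = g (inord i)) -> s =1 g.
  move=> fg i; apply: val_inj; have im : i <= m by rewrite -ltnS.
    by have := fg i im; rewrite /f inord_val.
case: (step 0 m0) => f1; [left | right]; apply/permP => i; rewrite ?perm1 ?permE.
  have H j : j < m -> f j = f 0 + j /\ f j.+1 = f 0 + j.+1.
    elim: j => [|j IH] jm; first by rewrite f1; lia.
    have [H1 H2] := IH (ltnW jm); have := fI j j.+2; have := step _ jm; lia.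
  apply: (ext id) => {}i im; rewrite inordK //.
  have H' j : j <= m -> f j = f 0 + j by case: j => [|j /H[]//]; rewrite addn0.
  by have := H' m; have := H' i im; have := fm m; lia.
have H j : j < m -> f j + j = f 0 /\ f j.+1 + j.+1 = f 0.
  elim: j => [|j IH] jm; first by lia.
  have [H1 H2] := IH (ltnW jm); have := fI j j.+2; have := step _ jm; lia.
apply: (ext (@rev_ord _)) => {}i im; rewrite /= inordK //.
have H' j : j <= m -> f j + j = f 0 by case: j => [|j /H[]//]; rewrite addn0.
by have := H' m; have := H' i im; have := fm 0; lia.
Qed.

(** Each path has at most two orderings, one the reversal of the other. *)
Lemma leq_card_ham_paths n : n`! <= 2 * #|ham_paths n|.
Proof.
rewrite mulnC -sum_nat_const -(card_Sn n) -sum1_card.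
rewrite (partition_big (fun p : 'S_n => relabel p (std_path n)) (mem (ham_paths n))) /=; last first.
  by move=> p _; apply/ham_pathsP; exists p.
apply: leq_sum => P /ham_pathsP[p0 E]; rewrite sum1_card.
apply: leq_trans (_ : #|[set p0; (perm (@rev_ord_inj n) * p0)%g]| <= _); last first.
  by rewrite cards2; case: (_ != _).
apply/subset_leq_card/subsetP => p Hp.
have {Hp} pP : relabel p (std_path n) = P by apply/eqP.
have : relabel (p * p0^-1)%g (std_path n) \subset std_path n.
  rewrite (@eq_relabel _ _ (p0^-1%g \o p)); last by move=> x; rewrite permM.
  rewrite relabel_comp pP E -relabel_comp (@eq_relabel _ _ id) ?relabel_id //.
  exact: permK.
case/std_path_automorphism=> /(canRL (mulgKV p0)) ->.
  by rewrite mul1g !inE eqxx.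
by rewrite !inE eqxx orbT.
Qed.

(** * Paths whose union with the standard path has no even cycle *)

(** On pairs [i < j <= m], for [a] and [b] other than 1: the standard path with
    the edge [{a - 1, a}] replaced by the chord [{0, a}] and the edge
    [{m - b, m - b + 1}] replaced by [{m - b, m}]; nothing is replaced at an end
    when [a = 0] or [b = 0]. *)
Definition flipped (m a b : nat) : rel nat := fun i j =>
  if j == i.+1 then (j != a) && (i + b != m)
  else (i == 0) && (j == a) || (i + b == m) && (j == m).

(** On pairs [i < j <= m]: the Hamiltonian cycle minus the edge [{c, c + 1}]. *)
Definition cycle_minus (m c : nat) : rel nat := fun i j =>
  if j == i.+1 then i != c else (i == 0) && (j == m).

Section Adj.
Variable m : nat.
Local Notation n := m.+1.
Implicit Types (G : graph n) (i j k l : nat).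

(** Integer vertices make room for the arithmetic on intervals; [inord] gives junk
    values from [n] on, whence the bounds [_ < n] below. *)
Definition adj G : rel nat := fun i j => [set inord i; inord j] \in G.

Lemma adjC G i j : adj G i j = adj G j i.
Proof. by rewrite /adj setUC. Qed.

Lemma nat_cycle G (c : seq nat) : all (ltn^~ n) c -> uniq c -> 2 < size c ->
  path.cycle (adj G) c -> is_cycle G (map inord c).
Proof.
move=> /allP cn Uc c2 Cc; rewrite /is_cycle size_map c2 cycle_map Cc andbT.
rewrite map_inj_in_uniq // => x y xc yc /(congr1 val) /=.
by rewrite !inordK; [|exact: cn yc|exact: cn xc].
Qed.

Lemma path_iota (r : rel nat) i k :
  (forall x, i <= x < i + k -> r x x.+1) -> path r i (iota i.+1 k).
Proof.
elim: k i => [|k IH] i H //=; rewrite H ?IH //; last lia.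
by move=> x xk; apply: H; lia.
Qed.

Lemma path_rev_iota (r : rel nat) i k :
  (forall x, i <= x < i + k -> r x.+1 x) -> path r (i + k) (rev (iota i k)).
Proof.
elim: k => [|k IH] H //; rewrite -addn1 iotaD rev_cat /= addn1 addnS H ?IH //; last lia.
by move=> x xk; apply: H; lia.
Qed.

Lemma cycle_cat (T : Type) (r : rel T) x a y b :
  path.cycle r ((x :: a) ++ (y :: b)) =
  [&& path r x a, r (last x a) y, path r y b & r (last y b) x].
Proof. by rewrite /= rcons_cat cat_path rcons_cons /= rcons_path. Qed.

Lemma iotaS i k : iota i k.+1 = i :: iota i.+1 k.
Proof. by []. Qed.

Lemma last_iotaS i j : i <= j -> last i (iota i.+1 (j - i)) = j.
Proof.
by move=> ij; rewrite -[LHS]/(last i (iota i (j - i).+1)) -addn1 iotaD last_cat /= subnKC.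
Qed.

Lemma interval_cycle G i j : i.+1 < j -> j < n ->
  (forall k, i <= k < j -> adj G k k.+1) -> adj G i j ->
  is_cycle G (map inord (iota i (j - i).+1)).
Proof.
move=> ij jn H Gij; apply: nat_cycle; rewrite ?iota_uniq ?size_iota; [|done|lia|].
  by apply/allP => k; rewrite mem_iota /=; lia.
rewrite /= rcons_path path_iota; last by move=> x xj; apply: H; lia.
by rewrite last_iotaS 1?adjC // ltnW // ltnW.
Qed.

(** The cycle of two overlapping chords that avoids the overlap: up from [i] to
    [k], across to [l], down to [j], and back. *)
Lemma crossing_cycle G i k j l : i < k -> k < j -> j < l -> l < n ->
  (forall x, x.+1 < n -> adj G x x.+1) -> adj G i j -> adj G k l ->
  is_cycle G (map inord (iota i (k - i).+1 ++ rev (iota j (l - j).+1))).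
Proof.
move=> ik kj jl ln H Gij Gkl; apply: nat_cycle.
- by apply/allP => x; rewrite mem_cat mem_rev !mem_iota /=; lia.
- rewrite cat_uniq rev_uniq !iota_uniq andbT; apply/hasPn => x.
  by rewrite mem_rev !mem_iota; lia.
- by rewrite size_cat size_rev !size_iota; lia.
have -> : rev (iota j (l - j).+1) = l :: rev (iota j (l - j)).
  by rewrite -addn1 iotaD rev_cat /= subnKC // ltnW.
rewrite iotaS cycle_cat path_iota; last by move=> x xj; apply: H; lia.
rewrite last_iotaS ?Gkl 1?ltnW //; have {1}-> : l = j + (l - j) by lia.
rewrite path_rev_iota; last by move=> x xj; rewrite adjC; apply: H; lia.
have -> : l - j = (l - j).-1.+1 by lia.
by rewrite /= rev_cons last_rcons adjC.
Qed.

(** For nested chords: up from [i] to [k], across to [l], up to [j], and back. *)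
Lemma nested_cycle G i k j l : i <= k -> k.+1 < l -> l <= j -> j < n ->
  (i, j) != (k, l) ->
  (forall x, x.+1 < n -> adj G x x.+1) -> adj G i j -> adj G k l ->
  is_cycle G (map inord (iota i (k - i).+1 ++ iota l (j - l).+1)).
Proof.
move=> ik kl lj jn ne H Gij Gkl; apply: nat_cycle.
- by apply/allP => x; rewrite mem_cat !mem_iota /=; lia.
- rewrite cat_uniq !iota_uniq andbT; apply/hasPn => x.
  by rewrite !mem_iota; lia.
- by move: ne; rewrite xpair_eqE size_cat !size_iota; lia.
rewrite !iotaS cycle_cat.
rewrite path_iota; last by move=> x xj; apply: H; lia.
rewrite path_iota; last by move=> x xj; apply: H; lia.
by rewrite !last_iotaS // Gkl adjC.
Qed.

Variable t : seq 'I_n.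
Hypothesis Ut : uniq t.
Hypothesis tT : forall x, x \in t.
Local Notation Q := (path_graph t).

Lemma adj_degree i j k l : i < n -> j < n -> k < n -> l < n ->
  adj Q i j -> adj Q i k -> adj Q i l -> [|| j == k, j == l | k == l].
Proof.
move=> ii jj kk ll.
move=> /(path_graph_index Ut)[_ _ J] /(path_graph_index Ut)[_ _ K] /(path_graph_index Ut)[_ _ L].
have E a b : a < n -> b < n -> index (inord a) t = index (inord b : 'I_n) t -> a = b.
  move=> an bn /(congr1 (nth ord0 t)); rewrite !nth_index // => /(congr1 val) /=.
  by rewrite !inordK.
have := E j k jj kk; have := E j l jj ll; have := E k l kk ll; lia.
Qed.

Lemma adj_irr i : ~~ adj Q i i.
Proof. by apply/negP => /(path_graph_index Ut)[_ _]; lia. Qed.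

(** Connectedness of a Hamiltonian path, as the existence of an edge across every
    cut. *)
Lemma crossing (S : pred nat) i j : i < n -> j < n -> S i -> ~~ S j ->
  exists x y, [/\ x < n, y < n, adj Q x y, S x & ~~ S y].
Proof.
move=> ii jj Si Sj.
case: (boolP [exists x : 'I_n, exists y : 'I_n, [&& adj Q x y, S x & ~~ S y]]).
  by case/existsP=> x /existsP[y /and3P[*]]; exists x, y; split.
rewrite negb_exists => /forallP H.
have const k : k < size t -> S (nth ord0 t k) = S (nth ord0 t 0).
  elim: k => // k IH kt; rewrite -(IH (ltnW kt)).
  have := path_graph_nth ord0 kt.
  move: (nth ord0 t k) (nth ord0 t k.+1) => x y xy.
  have := H x; rewrite negb_exists => /forallP/(_ y).
  have := H y; rewrite negb_exists => /forallP/(_ x).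
  rewrite (adjC _ y x) {1 2}/adj !inord_val xy.
  by case: (S _); case: (S _).
have St x : x < n -> S x = S (nth ord0 t 0).
  move=> xn; rewrite -(const (index (inord x) t)) ?index_mem //.
  by rewrite nth_index // inordK.
by move: Sj; rewrite St // -(St i) // Si.
Qed.


Hypothesis noev : ~~ has_cycle evens (std_path n :|: Q).
Local Notation G := (std_path n :|: Q).

Definition chord i j := [&& i.+1 < j, j < n & adj Q i j].
Definition gap k := (k.+1 < n) && ~~ adj Q k k.+1.

Lemma adj_std x : x.+1 < n -> adj G x x.+1.
Proof.
by move=> xn; rewrite /adj in_setU std_pathE !inordK ?eqxx // ltnW.
Qed.

Lemma adjQG x y : adj Q x y -> adj G x y.
Proof. by rewrite /adj in_setU => ->; rewrite orbT. Qed.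

Lemma cycle_odd c : is_cycle G c -> odd (size c).
Proof.
by move=> Gc; apply: contraR noev => ec; apply/has_cycleP; exists c.
Qed.

Lemma chord_even i j : chord i j -> ~~ odd (j - i).
Proof.
case/and3P=> ij jn /adjQG Qij.
have /cycle_odd : is_cycle G (map inord (iota i (j - i).+1)).
  by apply: interval_cycle => // k kj; apply: adj_std; lia.
by rewrite size_map size_iota.
Qed.

(** If two chord cycles, both odd, share a standard edge, then their symmetric
    difference is an even cycle. *)
Lemma chord_disjoint i j k l x : chord i j -> chord k l ->
  i <= x < j -> k <= x < l -> i = k /\ j = l.
Proof.
move=> ij kl xj xl.
wlog ik : i j k l ij kl xj xl / (i < k) || (i == k) && (l <= j).
  move=> W; case: (boolP ((i < k) || (i == k) && (l <= j))); first exact: W.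
  by move=> H; have := W k l i j; case=> //; lia.
case/and3P: (ij) => ij2 jn /adjQG Qij; case/and3P: (kl) => kl2 ln /adjQG Qkl.
have /negP ev1 := chord_even ij; have /negP ev2 := chord_even kl.
case: (leqP l j) => lj; last first.
  have := cycle_odd (@crossing_cycle _ i k j l _ _ lj ln adj_std Qij Qkl).
  by rewrite size_map size_cat size_rev !size_iota; lia.
case: (eqVneq (i, j) (k, l)) => [[-> ->] //|ne].
have := cycle_odd (@nested_cycle _ i k j l _ kl2 lj jn ne adj_std Qij Qkl).
by rewrite size_map size_cat !size_iota; lia.
Qed.

(** Otherwise the path would contain the whole cycle of the chord. *)
Lemma chord_gap i j : chord i j -> exists2 x, i <= x < j & gap x.
Proof.
case/and3P=> ij jn Qij.
case: (boolP [exists x : 'I_n, (i <= x < j) && gap x]).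
  by case/existsP=> x /andP[xj mx]; exists x.
rewrite negb_exists => /forallP H; exfalso.
apply: (path_graph_acyclic Ut (interval_cycle ij jn _ Qij)) => k kj.
have kn : k < n by lia.
have := H (Ordinal kn); rewrite /= kj /gap /= -ltnS.
have -> : k.+2 < n.+1 by lia.
by rewrite negbK.
Qed.

(** Only a chord can then join the vertices up to [x] to those after [x]. *)
Lemma gap_chord x : gap x -> exists i j, chord i j /\ i <= x < j.
Proof.
case/andP=> xn nx.
have [||||i [j [ii jj ij Si Sj]]] := @crossing (fun k => k <= x) x x.+1 => //=; try lia.
exists i, j; rewrite /chord ij jj !andbT; split; last lia.
have : i.+1 != j; last lia.
by apply: contra nx => /eqP E; have -> : x = i by [lia]; rewrite E.
Qed.

(** The vertices strictly after one gap and up to a second one under the same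
    chord could be linked to the others only by another chord over one of these
    gaps. *)
Lemma chord_gap_unique i j x y : chord i j -> gap x -> gap y ->
  i <= x < j -> i <= y < j -> x = y.
Proof.
wlog xy : x y / x <= y.
  by move=> W ij mx my xj yj; case: (leqP x y) => [|/ltnW] /W; [|symmetry]; auto.
move=> ij mx my xj yj; apply/eqP; apply: contraT => ne.
have [||||k [l [kk ll kl Sk Sl]]] := @crossing (fun k => x < k <= y) y i => //=; try lia.
- by case/and3P: ij; lia.
- by case/and3P: ij; lia.
have sub w : gap w -> k = w.+1 -> l = w -> False.
  by case/andP=> _ /negP nw E F; apply: nw; rewrite adjC -E -F.
have sub' w : gap w -> k = w -> l = w.+1 -> False.
  by case/andP=> _ /negP nw E F; apply: nw; rewrite -F -E.
have [s1 s2] := (sub x mx, sub' y my).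
case: (ltnP k l) => kltl.
  have c1 : chord k l by rewrite /chord kl ll; lia.
  by have [] := chord_disjoint (x := y) ij c1; lia.
have c1 : chord l k by rewrite /chord adjC kl kk andbT /=; move: Sk Sl => /=; have := s1; lia.
by have [] := chord_disjoint (x := x) ij c1; lia.
Qed.

(** The chord and the edge [{i, i + 1}] use up the degree of [i].  If [i > 0], the
    edge [{i - 1, i}] is then a gap, and its chord, ending at [i] by
    disjointness, would be a third edge at [i]. *)
Lemma chord_left_end i j x : chord i j -> gap x -> i < x < j -> i = 0.
Proof.
move=> ij mx xj; apply/eqP; apply: contraT => i0; case/and3P: (ij) => ij2 jn Qij.
have Qi : adj Q i i.+1.
  apply: contraT => nQ; have mi : gap i by rewrite /gap nQ andbT; lia.
  by have := chord_gap_unique ij mi mx; lia.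
have Qi' : ~~ adj Q i i.-1.
  by apply/negP => Q'; have := @adj_degree i i.+1 j i.-1; rewrite Qij Qi Q'; lia.
have /gap_chord[k [l [kl il]]] : gap i.-1.
  by rewrite /gap prednK ?lt0n // adjC Qi' andbT; lia.
case: (ltnP i l) => ll.
  by have [] := chord_disjoint (x := i) ij kl; lia.
have li : l = i by lia.
case/and3P: kl => kl ln; rewrite li adjC => Qik.
by have := @adj_degree i i.+1 j k; rewrite Qij Qi Qik; lia.
Qed.

Lemma chord_right_end i j x : chord i j -> gap x -> i <= x -> x.+1 < j -> j = m.
Proof.
move=> ij mx ix xj; apply/eqP; apply: contraT => jm; case/and3P: (ij) => ij2 jn Qij.
have Qj : adj Q j j.-1.
  rewrite adjC; apply: contraT => nQ; have mi : gap j.-1.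
    rewrite /gap prednK ?nQ ?jn //; lia.
  by have := chord_gap_unique ij mi mx; lia.
rewrite adjC in Qij.
have Qi' : ~~ adj Q j j.+1.
  by apply/negP => Q'; have := @adj_degree j j.-1 i j.+1; rewrite Qij Qj Q'; lia.
have /gap_chord[k [l [kl il]]] : gap j by rewrite /gap Qi' andbT; lia.
case: (ltnP k j) => ll.
  by have [] := chord_disjoint (x := j.-1) ij kl; lia.
have li : k = j by lia.
case/and3P: kl => kl ln; rewrite li => Qik.
by have := @adj_degree j j.-1 i l; rewrite Qij Qj Qik; lia.
Qed.


Lemma path_graph_of (e : rel nat) :
  (forall i j, i < j -> j < n -> adj Q i j = e i j) -> Q = graph_of n e.
Proof.
move=> Qe; have QE (x y : 'I_n) : x < y -> ([set x; y] \in Q) = e x y.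
  by move=> xy; rewrite -Qe // /adj !inord_val.
apply/setP=> E; apply/idP/idP.
  move=> EQ; have [x [y Exy]] : exists x y, E = [set x; y].
    by move: EQ; rewrite inE => /mapP[[x y] _ ->]; exists x, y.
  rewrite Exy graph_ofE in EQ *; case: (ltngtP x y) => xy /=.
  - by rewrite -QE ?EQ.
  - by rewrite -QE // setUC EQ.
  have := adj_irr x; rewrite /adj !inord_val.
  by rewrite {2}(val_inj xy) EQ.
by case/imsetP=> -[x y]; rewrite inE /= => /andP[xy exy] ->; rewrite QE.
Qed.

Definition left_chord a := chord 0 a && gap a.-1.
Definition right_chord b := [&& b <= m, chord (m - b) m & gap (m - b)].

Lemma classify_chord i j x : chord i j -> gap x -> i <= x < j ->
  [\/ i = 0 /\ x.+1 = j, j = m /\ x = i | [/\ i = 0, j = m & 0 < x < m.-1]].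
Proof.
move=> ij mx xj; have := chord_left_end ij mx; have := chord_right_end ij mx.
case/and3P: ij => ij jn _.
case: (x =P i) => xi; case: (x.+1 =P j) => xj1 R L.
- by constructor 1; lia.
- by constructor 2; lia.
- by constructor 1; lia.
- by constructor 3; split; lia.
Qed.

(** When no chord makes the path a Hamiltonian cycle minus an inner edge, the left
    and right chords determine everything; [a = 0] and [b = 0] encode that there
    is none. *)
Lemma adj_flipped a b :
  (forall x, chord 0 m -> gap x -> ~~ (0 < x < m.-1)) ->
  (if a == 0 then forall j, ~~ left_chord j else left_chord a) ->
  (if b == 0 then forall j, 0 < j -> ~~ right_chord j else right_chord b) ->
  forall i j, i < j -> j < n -> adj Q i j = flipped m a b i j.
Proof.
move=> noC La Rb.
have key i j x : chord i j -> gap x -> i <= x < j ->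
  (a != 0 /\ (i = 0 /\ j = a /\ x = a.-1)) \/
  (b != 0 /\ (j = m /\ i + b = m /\ x = i)).
  move=> ij mx xj; have /and3P[ij2 jn _] := ij.
  case: (classify_chord ij mx xj) => [[i0 xj1]|[jm xi]|[i0 jm xm]].
  - have Lj : left_chord j by rewrite /left_chord -xj1 /= mx -i0 xj1 ij.
    left; case: eqP La => [_ /(_ j)|_]; first by rewrite Lj.
    case/andP=> a1 _; rewrite i0 in ij; split=> //.
    have /and3P[a2 _ _] := a1.
    by have [] := chord_disjoint (x := 0) ij a1; lia.
  - have Rj : right_chord (m - i).
      by rewrite /right_chord leq_subr subKn -?xi ?mx ?xi -?jm ?ij //; lia.
    right; case: eqP Rb => [_ /(_ (m - i))|_]; first by rewrite Rj => /(_ _)/negP; lia.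
    case/and3P=> bm b1 _; rewrite jm in ij; split=> //.
    have /and3P[b2 _ _] := b1.
    by have [] := chord_disjoint (x := m.-1) ij b1; lia.
  rewrite i0 jm in ij; have := noC x ij mx; rewrite xm; lia.
have La' : a != 0 -> left_chord a by case: eqP La.
have Rb' : b != 0 -> right_chord b by case: eqP Rb.
move=> i j ij jn; rewrite /flipped; case: eqP => [ji|ji].
  rewrite ji in jn *.
  have -> : adj Q i i.+1 = ~~ gap i by rewrite /gap jn negbK.
  apply/idP/idP.
    move=> nm; apply/andP; split; apply: contra nm => /eqP E.
      have a0 : a != 0 by lia.
      by case/andP: (La' a0) => _; rewrite -E.
    have b0 : b != 0 by lia.
    by case/and3P: (Rb' b0) => _ _; have -> : m - b = i by lia.
  case/andP=> ia ib; apply/negP => mi.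
  have [k [l [kl il]]] := gap_chord mi.
  by case: (key _ _ _ kl mi il); lia.
have -> : adj Q i j = chord i j by rewrite /chord jn /=; have -> : i.+1 < j by lia.
apply/idP/idP.
  move=> cij; have [x xj mx] := chord_gap cij.
  by case: (key _ _ _ cij mx xj); lia.
case/orP=> /andP[/eqP E /eqP F].
  have a0 : a != 0 by lia.
  by rewrite E F; case/andP: (La' a0).
have b0 : b != 0 by lia.
by case/and3P: (Rb' b0) => _; rewrite F; have -> : m - b = i by lia.
Qed.

Lemma adj_cycle_minus c : chord 0 m -> gap c -> 
  forall i j, i < j -> j < n -> adj Q i j = cycle_minus m c i j.
Proof.
move=> cm mc i j ij jn; have /and3P[m1 _ _] := cm; rewrite /cycle_minus.
have mn x : gap x -> x < m by case/andP.
case: eqP => [ji|ji].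
  rewrite ji in jn *.
  have -> : adj Q i i.+1 = ~~ gap i by rewrite /gap jn negbK.
  congr (~~ _); apply/idP/eqP => [mi|-> //].
  by apply: (chord_gap_unique cm mi mc); rewrite /= mn.
have -> : adj Q i j = chord i j by rewrite /chord jn /=; have -> : i.+1 < j by lia.
apply/idP/andP => [cij|[/eqP-> /eqP-> //]].
have [x xj mx] := chord_gap cij.
by have [] := chord_disjoint (x := x) cij cm; lia.
Qed.

(** The spans [2a] and [2b] of the end chords satisfy [2a + 2b <= m].  The cycle
    minus one of its first or last standard edges already occurs with [a] or [b]
    maximal, so [cycle_minus] is only needed for [0 < c < m - 1]. *)
Definition candidates : seq (graph n) :=
  [seq graph_of n (flipped m a.*2 b.*2) | a <- iota 0 m./2.+1, b <- iota 0 (m./2.+1 - a)]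
  ++ (if odd n then [seq graph_of n (cycle_minus m c) | c <- iota 1 (m - 2)] else [::]).

Lemma path_graph_candidates : Q \in candidates.
Proof.
rewrite mem_cat.
case: (boolP (chord 0 m && [exists c : 'I_n, (0 < c < m.-1) && gap c])) => [/andP[cm]|].
  case/existsP=> c /andP[c0 mc]; apply/orP; right.
  have -> : odd n by have := chord_even cm; rewrite subn0.
  apply/mapP; exists (nat_of_ord c); first by rewrite mem_iota; lia.
  by apply: path_graph_of; apply: adj_cycle_minus.
move=> noC; apply/orP; left.
have noC' x : chord 0 m -> gap x -> ~~ (0 < x < m.-1).
  move=> cm mx; apply: contra noC => x0; rewrite cm; apply/existsP.
  have xn : x < n by case/andP: mx; lia.
  by exists (Ordinal xn); rewrite /= x0 mx.
have [a aP] : exists a, if a == 0 then forall j, ~~ left_chord j else left_chord a.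
  case: (boolP [exists a : 'I_n, left_chord a]) => [/existsP[a La]|].
    by exists (nat_of_ord a); case: eqP La => // ->.
  rewrite negb_exists => /forallP H; exists 0 => /= j; apply/negP => Lj.
  have jn : j < n by case/andP: Lj => /and3P[].
  by have := H (Ordinal jn); rewrite Lj.
have [b bP] : exists b, if b == 0 then forall j, 0 < j -> ~~ right_chord j else right_chord b.
  case: (boolP [exists b : 'I_n, (0 < b) && right_chord b]) => [/existsP[b /andP[b0 Rb]]|].
    by exists (nat_of_ord b); case: eqP b0 Rb => // ->.
  rewrite negb_exists => /forallP H; exists 0 => /= j j0; apply/negP => Lj.
  have jn : j < n by case/and3P: Lj; lia.
  by have := H (Ordinal jn); rewrite Lj j0.
have ea : ~~ odd a.
  by case: eqP aP => [->|_] // /andP[/chord_even]; rewrite subn0.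
have eb : ~~ odd b.
  by case: eqP bP => [->|_] // /and3P[bm /chord_even]; rewrite subKn.
have abm : a + b <= m.
  have La' : a != 0 -> left_chord a by case: eqP aP.
  have Rb' : b != 0 -> right_chord b by case: eqP bP.
  case: (posnP a) => a0.
    case: (posnP b) => b0; first by rewrite a0 b0.
    by rewrite a0; case/and3P: (Rb' (lt0n_neq0 b0)).
  have /andP[ca mca] : left_chord a by apply: La'; lia.
  case: (posnP b) => b0; first by rewrite b0 addn0; case/and3P: ca.
  have /and3P[bm cb mcb] : right_chord b by apply: Rb'; lia.
  rewrite leqNgt; apply/negP => mab.
  (* Otherwise both are the chord {0, m}, with gaps next to both of its ends. *)
  move: mab (chord_disjoint (x := m - b) ca cb) (chord_gap_unique ca mca mcb).
  by case/and3P: ca; clear -a0 b0 bm; lia.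
apply/allpairsPdep; exists a./2, b./2; rewrite !mem_iota; split; try lia.
rewrite !even_halfK //; exact: path_graph_of (adj_flipped noC' aP bP).
Qed.

End Adj.

(** * Counting, and the theorem *)

Lemma sumn_triangle k : sumn [seq k - a | a <- iota 0 k] = 'C(k.+1, 2).
Proof.
elim: k => // k IH; rewrite binS bin1 -IH /= subn0 addnC; congr (sumn _ + _).
by rewrite -[1]/(1 + 0) iotaDl -map_comp; apply: eq_map => a /=; rewrite add1n subSS.
Qed.

Lemma size_candidates m :
  size (candidates m) = 'C(m./2.+2, 2) + (if odd m.+1 then m - 2 else 0).
Proof.
rewrite size_cat size_allpairs_dep -sumn_triangle; congr (sumn _ + _).
  by apply: eq_map => a; rewrite size_iota.
by case: ifP => _ //; rewrite size_map size_iota.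
Qed.

(** Undoing the relabelling of [P] reduces to the standard path. *)
Lemma not_cycle_different_bound m (P : graph m.+1) : P \in ham_paths m.+1 ->
  #|[set Q in ham_paths m.+1 | ~~ cycle_different evens P Q]| <= size (candidates m).
Proof.
case/ham_pathsP=> p ->.
rewrite -(size_map (relabel p)); apply: leq_trans (card_size _).
apply/subset_leq_card/subsetP => Q; rewrite inE => /andP[/ham_pathsP[q ->]].
rewrite /cycle_different; set r : 'S_m.+1 := (q * p^-1)%g.
have -> : relabel q (std_path m.+1) = relabel p (relabel r (std_path m.+1)).
  rewrite -relabel_comp; apply: eq_relabel => x.
  by rewrite /r /= permM permKV.
rewrite -relabelU has_cycle_relabelP => nev; apply: map_f.
move: nev; rewrite {2 3}/std_path !relabel_path; apply: path_graph_candidates.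
  by rewrite (map_inj_uniq perm_inj) enum_uniq.
by move=> x; apply/mapP; exists (r^-1%g x); rewrite ?mem_enum ?permKV.
Qed.

Lemma lower_bound m :
  m.+1`! <= 2 * (M m.+1 evens * ('C(m./2.+2, 2) + (if odd m.+1 then m - 2 else 0))).
Proof.
apply: leq_trans (leq_card_ham_paths _) _; rewrite leq_mul2l /= -size_candidates.
exact: greedy_bound (@not_cycle_different_bound m).
Qed.

Lemma upper_bound_odd n : odd n -> 1 < n -> M n evens * (n * 2) <= n`!.
Proof.
case: n => [|[|m]] // on _; have m2 : 2 < m.+2 by case: m on.
apply: leq_trans (template_bound (ham_cycle_no_even on)).
by rewrite leq_mul2l ham_cycle_orderings ?orbT.
Qed.

Lemma upper_bound_even n : 4 < n -> M n evens * 8 <= n`!.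
Proof.
move=> n4; apply: leq_trans (template_bound (two_triangles_no_even n4)).
by rewrite leq_mul2l two_triangles_orderings ?orbT.
Qed.

Import Order.TTheory GRing.Theory Num.Theory.
Local Open Scope ring_scope.

Theorem theorem1 (n : nat) (hn : (0 < n)%N) :
  (odd n ->
     (n`!)%:R / (2 * (n%:R - 3 + 'C((uphalf n).+1, 2)%:R)) <= (M n evens)%:R :> rat
     /\ ((1 < n)%N -> (M n evens)%:R <= (n`!)%:R / (2 * n%:R) :> rat))
  /\
  (~~ odd n ->
     (n`!)%:R / (2 * 'C((n./2).+1, 2)%:R) <= (M n evens)%:R :> rat
     /\ ((4 < n)%N -> (M n evens)%:R <= (n`!)%:R / 8 :> rat)).
Proof.
have upper (d : nat) : (0 < d)%N -> (M n evens * d <= n`!)%N ->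
    (M n evens)%:R <= (n`!)%:R / d%:R :> rat.
  by move=> d0 Md; rewrite ler_pdivlMr ?ltr0n // -natrM ler_nat.
have lower (d : nat) : (0 < d)%N -> (n`! <= 2 * (M n evens * d))%N ->
    (n`!)%:R / (2 * d%:R) <= (M n evens)%:R :> rat.
  move=> d0 Md; rewrite ler_pdivrMr -natrM ?ltr0n ?muln_gt0 // -natrM ler_nat.
  by rewrite mulnCA.
split=> on; split.
- have [n1|n1] := leqP n 1.
    (* For n = 1 the denominator is negative. *)
    have -> : n = 1%N by lia.
    apply: (@le_trans _ _ 0); last exact: ler0n.
    apply: mulr_ge0_le0; first exact: ler0n.
    by rewrite invr_le0.
  have -> : n%:R - 3 + 'C((uphalf n).+1, 2)%:R = ('C((uphalf n).+1, 2) + (n - 3))%N%:R :> rat.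
    have n3 : (3 <= n)%N by move: on n1; lia.
    by rewrite natrD natrB // addrC.
  apply: lower; first by rewrite addn_gt0 bin_gt0; lia.
  case: n hn on n1 {upper} => // m _ on _; have := lower_bound m.
  by rewrite on subSS.
- move=> n1; rewrite -natrM; apply: upper; first lia.
  by rewrite mulnC [(2 * _)%N]mulnC mulnC upper_bound_odd.
- apply: lower; first by rewrite bin_gt0; lia.
  case: n hn on {upper} => // m _ on; have := lower_bound m.
  by rewrite (negbTE on) addn0; have -> : m.+1./2 = m./2.+1 by lia.
by move=> n4; apply: upper (upper_bound_even n4).
Qed.
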